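(* Let $n\ge 0$ be an integer, let $h\in\mathbb{Z}$ and $r, w_1, w_2\in\mathbb{N}$, let $q\in\mathbb{C}_p$ with $q\neq 1$ and $|1-q|_p<p^{-1/(p-1)}$, and let $x\in\mathbb{C}_p$ with $|x|_p\le 1$. Then $$[w_1]_q^{n-r}\sum_{j_1,\dots,j_r=0}^{w_1-1}q^{w_2\sum_{l=1}^r(h-l+1)j_l}\,\beta_{n,q^{w_1}}^{(h,r)}\left(w_2x+\frac{w_2}{w_1}(j_1+\cdots+j_r)\right)$$ $$=[w_2]_q^{n-r}\sum_{j_1,\dots,j_r=0}^{w_2-1}q^{w_1\sum_{l=1}^r(h-l+1)j_l}\,\beta_{n,q^{w_2}}^{(h,r)}\left(w_1x+\frac{w_1}{w_2}(j_1+\cdots+j_r)\right).$$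
   Context: $p$ is a fixed prime; $\mathbb{Z}_p$ is the ring of $p$-adic integers; $\mathbb{C}_p$ is the completion of an algebraic closure of $\mathbb{Q}_p$, with absolute value normalized by $|p|_p=p^{-1}$. $\mathbb{N}=\{1,2,3,\dots\}$. For $Q\in\mathbb{C}_p$ with $Q\ne 1$, $|1-Q|_p<p^{-1/(p-1)}$ and $z\in\mathbb{C}_p$ with $|z\log Q|_p<p^{-1/(p-1)}$, put $Q^z=\exp(z\log Q)$ ($p$-adic exponential and logarithm) and $[z]_Q=\frac{1-Q^z}{1-Q}$. If $q$ satisfies $q\ne1$, $|1-q|_p<p^{-1/(p-1)}$, then so does $q^{w}$ for every $w\in\mathbb{N}$. Since $\log(q^{w})=w\log q$, the expression $[z]_{q^{w}}$ is defined whenever $|wz|_p\le1$, and $(q^{w})^z=q^{wz}$; in particular $(q^{w_1})^{\frac{w_2}{w_1}j}=q^{w_2j}$. The $Q$-Volkenborn integral of a uniformly differentiable function $f:\mathbb{Z}_p\to\mathbb{C}_p$ (i.e. one whose difference quotient $\frac{f(x)-f(y)}{x-y}$ has a limit $f'(a)$ as $(x,y)\to(a,a)$, for every $a\in\mathbb{Z}_p$) is $$\int_{\mathbb{Z}_p}f(y)\,d\mu_Q(y)=\lim_{N\to\infty}\frac{1}{[p^N]_Q}\sum_{y=0}^{p^N-1}f(y)Q^y .$$ Multiple integrals are iterated integrals. For $n\ge0$, $h\in\mathbb{Z}$, $r\in\mathbb{N}$ define $$\beta_{n,Q}^{(h,r)}(z)=\int_{\mathbb{Z}_p}\cdots\int_{\mathbb{Z}_p}[z+y_1+\cdots+y_r]_Q^{n}\,Q^{\sum_{l=1}^r(h-l)y_l}\,d\mu_Q(y_1)\cdots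 d\mu_Q(y_r).$$ Convention: $a^0=1$ for all $a$, including $a=0$. *)

(* Defs.v *)
From HB Require Import structures.
From mathcomp Require Import all_boot all_order all_algebra.
From mathcomp Require Import all_classical all_reals all_analysis.

Set Implicit Arguments.
Unset Strict Implicit.
Unset Printing Implicit Defensive.

Import Order.TTheory GRing.Theory Num.Theory.

Local Open Scope classical_set_scope.
Local Open Scope ring_scope.

(* Fields with an ultrametric absolute value extending the p-adic one.  The
   norms of MathComp satisfy |x *+ n| = |x| *+ n, which excludes ultrametric
   ones; the absolute value is therefore a separate real-valued function. *)
HB.mixin Record isPadicValued (R : realType) (p : nat) C of GRing.Field C := {
  padic_abs : C -> R ;
  padic_abs_ge0 : forall x, 0 <= padic_abs x ;
  padic_abs_eq0 : forall x, (padic_abs x == 0) = (x == 0) ;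
  padic_absM : forall x y, padic_abs (x * y) = padic_abs x * padic_abs y ;
  padic_absD : forall x y,
    padic_abs (x + y) <= Num.max (padic_abs x) (padic_abs y) ;
  padic_abs_p : padic_abs p%:R = p%:R^-1 }.

#[short(type="padicFieldType")]
HB.structure Definition PadicField (R : realType) (p : nat) :=
  {C of GRing.Field C & isPadicValued R p C}.

Section PadicTopology.
Context {R : realType} {p : nat} {C : padicFieldType R p}.

Lemma padic_abs0 : padic_abs (0 : C) = 0 :> R.
Proof. by apply/eqP; rewrite padic_abs_eq0. Qed.

Lemma padic_abs1 : padic_abs (1 : C) = 1 :> R.
Proof.
have a1 : padic_abs (1 : C) != 0 :> R by rewrite padic_abs_eq0 oner_eq0.
by apply: (mulIf a1); rewrite mul1r -padic_absM mulr1.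
Qed.

Lemma padic_absN (x : C) : padic_abs (- x) = padic_abs x :> R.
Proof.
apply/eqP; rewrite -(@eqrXn2 _ 2) ?padic_abs_ge0 //.
by rewrite !expr2 -!padic_absM mulrNN.
Qed.

Definition padic_ball (x : C) (e : R) : set C :=
  [set y | padic_abs (x - y) < e].

Lemma padic_ball_center x (e : R) : 0 < e -> padic_ball x e x.
Proof. by rewrite /padic_ball /= subrr padic_abs0. Qed.

Lemma padic_ball_sym x y (e : R) : padic_ball x e y -> padic_ball y e x.
Proof. by rewrite /padic_ball /= -opprB padic_absN. Qed.

Lemma padic_ball_triangle x y z (e1 e2 : R) :
  padic_ball x e1 y -> padic_ball y e2 z -> padic_ball x (e1 + e2) z.
Proof.
rewrite /padic_ball /= => xy yz.
have -> : x - z = (x - y) + (y - z) by rewrite addrA subrK.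
apply: le_lt_trans (padic_absD _ _) _; rewrite gt_max; apply/andP; split.
  by rewrite (lt_le_trans xy) // lerDl ltW // (le_lt_trans _ yz) ?padic_abs_ge0.
by rewrite (lt_le_trans yz) // lerDr ltW // (le_lt_trans _ xy) ?padic_abs_ge0.
Qed.

End PadicTopology.

#[non_forgetful_inheritance]
HB.instance Definition _ (R : realType) (p : nat) (C : padicFieldType R p) :=
  isPointed.Build (PadicField.sort C) 0.

#[non_forgetful_inheritance]
HB.instance Definition _ (R : realType) (p : nat) (C : padicFieldType R p) :=
  hasNbhs.Build (PadicField.sort C) (nbhs_ball_ (@padic_ball R p C)).

Lemma padic_nbhsE (R : realType) (p : nat) (C : padicFieldType R p) :
  @nbhs C C = nbhs_ (entourage_ (@padic_ball R p C)).
Proof.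
rewrite predeq2E => x P; split => [[e e0 eP]|[A [e e0 eA] AP]].
  by exists [set xy | padic_ball xy.1 e xy.2]; [exists e|move=> y /xsectionP/eP].
by exists e => // y xy; apply/AP/xsectionP/eA.
Qed.

#[non_forgetful_inheritance]
HB.instance Definition _ (R : realType) (p : nat) (C : padicFieldType R p) :=
  Nbhs_isPseudoMetric.Build R (PadicField.sort C) (@padic_nbhsE R p C)
    padic_ball_center padic_ball_sym padic_ball_triangle erefl.

Section Subfields.
Context {R : realType} {p : nat} (C : padicFieldType R p).

(* When C is complete, the closure of Q in C is its completion. *)
Definition padic_Qp : set C := closure (range (@ratr C)).

Definition padic_Zp : set C := [set x | padic_Qp x /\ padic_abs x <= 1].

Definition padic_Qpbar : set C :=
  [set x | exists P : {poly C}, [/\ P != 0, forall i, padic_Qp P`_i & root P x]].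

(* C is the completion of an algebraic closure of Q_p: it is complete, and the
   elements algebraic over Q_p form a dense, algebraically closed subfield.
   This determines C up to isometric isomorphism. *)
Record is_padic_complex : Prop := {
  padic_complete : forall F : set_system C, ProperFilter F -> cauchy F -> cvg F ;
  padic_Qpbar_closed : forall P : {poly C}, (forall i, padic_Qpbar P`_i) ->
    (1 < size P)%N -> exists2 x : C, padic_Qpbar x & root P x ;
  padic_Qpbar_dense : dense padic_Qpbar }.

End Subfields.

Arguments padic_Qp {R p} C.
Arguments padic_Zp {R p} C.
Arguments padic_Qpbar {R p} C.

Section PadicZpNat.
Context {R : realType} {p : nat} {C : padicFieldType R p}.

Lemma padic_abs_nat (m : nat) : padic_abs (m%:R : C) <= 1 :> R.
Proof.
elim: m => [|m IH]; first by rewrite padic_abs0 ler01.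
rewrite -addn1 natrD; apply: le_trans (padic_absD _ _) _.
by rewrite ge_max IH /= mulr1n padic_abs1.
Qed.

Lemma padic_Zp_nat_subproof (m : nat) : (m%:R : C) \in padic_Zp C.
Proof.
apply/mem_set; split; last exact: padic_abs_nat.
by apply: subset_closure; exists m%:R => //; rewrite ratr_nat.
Qed.

Definition padic_Zp_nat (m : nat) : padic_Zp C := exist _ m%:R (padic_Zp_nat_subproof m).

End PadicZpNat.

Section Volkenborn.
Context {R : realType} {p : nat} {C : padicFieldType R p}.

Definition padic_exp (z : C) : C := limn (series (fun k => z ^+ k / k`!%:R)).

Definition padic_log (Q : C) : C :=
  limn (series (fun k => (-1) ^+ k * (Q - 1) ^+ k.+1 / k.+1%:R)).

Definition padic_pow (Q z : C) : C := padic_exp (z * padic_log Q).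

Definition qbracket (Q z : C) : C := (1 - padic_pow Q z) / (1 - Q).

(* Total: for functions that are not uniformly differentiable the limit may
   fail to exist, and the value is then unspecified. *)
Definition volkenborn (Q : C) (f : padic_Zp C -> C) : C :=
  limn (fun N => (qbracket Q (p ^ N)%:R)^-1 *
                 \sum_(0 <= y < p ^ N) f (padic_Zp_nat y) * Q ^+ y).

(* The variable y_1, head of the tuple, is integrated first. *)
Fixpoint volkenborn_iter (Q : C) (r : nat) : (r.-tuple (padic_Zp C) -> C) -> C :=
  match r with
  | 0 => fun F => F [tuple]
  | s.+1 => fun F =>
      volkenborn_iter Q (fun t : s.-tuple (padic_Zp C) =>
        volkenborn Q (fun y => F [tuple of y :: t]))
  end.

(* Ordinals start at 0, so that y_l is the component of index l - 1. *)
Definition qbernoulli (n : nat) (h : int) (r : nat) (Q z : C) : C :=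
  volkenborn_iter Q (fun y : r.-tuple (padic_Zp C) =>
    qbracket Q (z + \sum_(l < r) val (tnth y l)) ^+ n *
    padic_pow Q (\sum_(l < r) (h - l.+1%:Z)%:~R * val (tnth y l))).

End Volkenborn.

(* Main.v *)
Require Import Defs.
From HB Require Import structures.
From mathcomp Require Import all_boot all_order all_algebra.
From mathcomp Require Import all_classical all_reals all_analysis.
From mathcomp Require Import zify ring lra.

Set Implicit Arguments.
Unset Strict Implicit.
Unset Printing Implicit Defensive.

Import Order.TTheory GRing.Theory Num.Theory.
Import numFieldNormedType.Exports.

(** Why the theorem holds.

    Expanding the n-th power of [z + y_1 + ... + y_r]_Q = (1 - Q^z Q^y_1 ...
    Q^y_r) / (1 - Q) by the binomial formula turns the integrand of the
    q-Bernoulli polynomial into a linear combination of products of one-variable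
    exponentials Q^(m y), with m an integer, and these can be integrated
    explicitly.  With b = m + 1, the Riemann sum is geometric and

      (1 - Q) / (1 - Q^(p^N)) * (1 - Q^(b p^N)) / (1 - Q^b)

    tends to (1 - Q) b / (1 - Q^b), or to - (1 - Q) / log Q when b = 0.  Hence a
    closed form of the q-Bernoulli polynomial: [volkenborn_sum_cvg] is the
    one-variable integral, [volkenborn_iter_exp_sum] the iterated one, and
    [qbernoulliE] the result.

    Take Q = q^w1.  The j-dependence of one side of the theorem is then the
    product over l of q^(w2 b_l j_l), with b_l = k + h - l + 1 in the k-th
    binomial term, so the sum over j factors over l.  Up to quantities that are
    visibly symmetric in w1 and w2, each factor is

      b / (1 - q^(w1 b)) * (1 - q^(w1 w2 b)) / (1 - q^(w2 b)),

    or - 1 / log q when b = 0: it is symmetric too ([weighted_mean_sym],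
    [qbernoulli_sum_expansion]).  The powers of [w1]_q and of 1 - q^w1 cancel
    down to (1 - q)^(r - n).

    All this rests on exp (a + b) = exp a exp b, exp (log Q) = Q and
    log (Q^b) = b log Q on the disc of radius p^(-1/(p-1)).  The first comes from
    the Cauchy product, by the bound p^(-k/(p-1)) <= |(k+1)!|.  The others avoid
    any composition of power series: they follow from the formula

      log Q = lim (Q^(p^N) - 1) / p^N                      ([padic_log_lim]),

    which makes log additive and gives log (exp z) = z at once, because
    exp (z)^(p^N) = exp (p^N z) = 1 + p^N z + O(p^(2N)); since log has a trivial
    kernel on the disc, exp (log Q) = Q follows.  The same formula evaluates the
    limit of the Riemann sums above, for b = 0 as well as for b nonzero. *)

Local Open Scope classical_set_scope.
Local Open Scope ring_scope.

(** * Ultrametric absolute value and limits *)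

Section AbsoluteValue.
Context {R : realType} {p : nat} {C : padicFieldType R p}.
Local Notation av := (@padic_abs R p C).
Implicit Types (x y : C) (u v : nat -> C).

Lemma padic_abs_gt0 x : (0 < av x) = (x != 0).
Proof. by rewrite lt_def padic_abs_ge0 padic_abs_eq0 andbT. Qed.

Lemma padic_absX x n : av (x ^+ n) = av x ^+ n.
Proof.
by elim: n => [|n IH]; rewrite ?expr0 ?padic_abs1 // !exprS padic_absM IH.
Qed.

Lemma padic_absV x : av x^-1 = (av x)^-1.
Proof.
have [->|x0] := eqVneq x 0; first by rewrite invr0 padic_abs0 invr0.
have ax0 : av x != 0 by rewrite padic_abs_eq0.
by apply: (mulIf ax0); rewrite -padic_absM !mulVf // padic_abs1.
Qed.

Lemma padic_abs_div x y : av (x / y) = av x / av y.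
Proof. by rewrite padic_absM padic_absV. Qed.

Lemma padic_abs_sign n : av ((-1) ^+ n) = 1.
Proof. by rewrite padic_absX padic_absN padic_abs1 expr1n. Qed.

Lemma padic_abs_distC x y : av (x - y) = av (y - x).
Proof. by rewrite -opprB padic_absN. Qed.

Lemma padic_absD_le (M : R) x y : av x <= M -> av y <= M -> av (x + y) <= M.
Proof. by move=> xM yM; rewrite (le_trans (padic_absD _ _)) // ge_max xM. Qed.

Lemma padic_absB_le (M : R) x y : av x <= M -> av y <= M -> av (x - y) <= M.
Proof. by move=> xM yM; rewrite padic_absD_le // padic_absN. Qed.

Lemma padic_absD_triangle x y : av (x + y) <= av x + av y.
Proof. by apply: padic_absD_le; rewrite (lerDl, lerDr) padic_abs_ge0. Qed.

Lemma padic_abs_sum_le (F : nat -> C) m n (M : R) : 0 <= M ->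
  (forall i, (m <= i < n)%N -> av (F i) <= M) -> av (\sum_(m <= i < n) F i) <= M.
Proof.
move=> M0 FM; rewrite big_nat_cond; elim/big_rec: _ => [|i x /andP[mn _] xM].
  by rewrite padic_abs0.
by apply: padic_absD_le; rewrite ?FM.
Qed.

(** The strict ball of radius 1 around 1 lies on the unit sphere: in an
    ultrametric space, points of a ball are equidistant from outside points. *)
Lemma padic_absB_near1 x : av (1 - x) < 1 -> av x = 1.
Proof.
move=> x1; apply/eqP; rewrite eq_le; apply/andP; split.
  rewrite -[x](subKr 1) padic_absB_le ?padic_abs1 //.
  exact: ltW.
rewrite leNgt; apply/negP => ltx1.
have : av (1 - x + x) <= Num.max (av (1 - x)) (av x) by exact: padic_absD.
by rewrite subrK padic_abs1 leNgt gt_max x1 ltx1.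
Qed.

(** Limits in [C] become limits of real sequences, for which squeezing and the
    algebraic limit laws are at hand. *)
Lemma padic_cvgP u (l : C) :
  u @ \oo --> l <-> av (u n - l) @[n --> \oo] --> (0 : R).
Proof.
split=> [/cvg_ballP ul|/cvgrPdistC_lt ul].
  apply/cvgrPdistC_lt => e e0; near=> n.
  rewrite subr0 ger0_norm ?padic_abs_ge0 // padic_abs_distC.
  by near: n; exact: ul.
apply/cvg_ballP => e e0; near=> n.
change (av (l - u n) < e).
rewrite padic_abs_distC -[ltLHS]ger0_norm ?padic_abs_ge0 // -[X in `|X|]subr0.
by near: n; exact: ul.
Unshelve. all: by end_near.
Qed.

Lemma padic_cvg_le u (l : C) (e : nat -> R) :
  (forall n, av (u n - l) <= e n) -> e @ \oo --> 0 -> u @ \oo --> l.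
Proof.
move=> ue e0; apply/padic_cvgP; apply: squeeze_cvgr (cvg_cst 0) e0.
by near=> n; rewrite padic_abs_ge0 ue.
Unshelve. all: by end_near.
Qed.

Lemma padic_cvg_cst (l : C) : (fun _ => l) @ \oo --> l.
Proof. exact: cvg_cst. Qed.

Lemma padic_cvgD u v (l m : C) :
  u @ \oo --> l -> v @ \oo --> m -> (fun n => u n + v n) @ \oo --> l + m.
Proof.
move=> /padic_cvgP ul /padic_cvgP vm.
apply: (@padic_cvg_le _ _ (fun n => av (u n - l) + av (v n - m))).
  by move=> n; rewrite opprD addrACA padic_absD_triangle.
by rewrite -[0]addr0; exact: cvgD.
Qed.

Lemma padic_cvg_abs u (l : C) : u @ \oo --> l -> av (u n) @[n --> \oo] --> av l.
Proof.
move=> /padic_cvgP ul; apply/cvgrPdistC_lt => e e0; near=> n.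
apply: (@le_lt_trans _ _ (av (u n - l))); last first.
  rewrite -[ltLHS]ger0_norm ?padic_abs_ge0 // -[X in `|X|]subr0.
  by near: n; move/cvgrPdistC_lt : ul; exact.
have := padic_absD_triangle (u n - l) l.
have := padic_absD_triangle (l - u n) (u n).
rewrite !subrK (padic_abs_distC l) => ? ?.
by rewrite ler_norml; apply/andP; split; lra.
Unshelve. all: by end_near.
Qed.

Lemma padic_cvgM u v (l m : C) :
  u @ \oo --> l -> v @ \oo --> m -> (fun n => u n * v n) @ \oo --> l * m.
Proof.
move=> ul vm.
apply: (@padic_cvg_le _ _ (fun n => av (u n - l) * av (v n) + av l * av (v n - m))).
  move=> n; rewrite -!padic_absM.
  have -> : u n * v n - l * m = (u n - l) * v n + l * (v n - m) by ring.
  exact: padic_absD_triangle.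
have -> : 0 = 0 * av m + av l * 0 :> R by rewrite mul0r mulr0 addr0.
apply: cvgD; apply: cvgM; [exact/padic_cvgP|exact: padic_cvg_abs|exact: cvg_cst|].
exact/padic_cvgP.
Qed.

Lemma padic_cvg_sum (I : Type) (s : seq I) (F : I -> nat -> C) (L : I -> C) :
  (forall i, F i @ \oo --> L i) ->
  (fun n => \sum_(i <- s) F i n) @ \oo --> \sum_(i <- s) L i.
Proof.
move=> FL; elim: s => [|i s IH].
  rewrite big_nil; under eq_fun do rewrite big_nil; exact: padic_cvg_cst.
by rewrite big_cons; under eq_fun do rewrite big_cons; exact: padic_cvgD.
Qed.

Lemma padic_hausdorff : hausdorff_space (PadicField.sort C).
Proof.
rewrite ball_hausdorff => a b ab.
(* Two balls of radius |a - b| around a and b are disjoint. *)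
have d0 : 0 < av (a - b) by rewrite padic_abs_gt0 subr_eq0.
exists (PosNum d0, PosNum d0) => /=.
apply/eqP/seteqP; split=> // y [] ay yb.
have {}ay : av (a - y) < av (a - b) by exact: ay.
have {}yb : av (y - b) < av (a - b) by rewrite padic_abs_distC; exact: yb.
have := padic_absD (a - y) (y - b).
by rewrite addrA subrK leNgt gt_max ay yb.
Qed.

Lemma padic_limE u (l : C) : u @ \oo --> l -> limn u = l.
Proof. exact: (cvg_lim padic_hausdorff). Qed.

Lemma padic_cvg_unique u (l m : C) : u @ \oo --> l -> u @ \oo --> m -> l = m.
Proof. by move=> /padic_limE <- /padic_limE <-. Qed.

Lemma padic_lim_le u (l c : C) (M : R) :
  u @ \oo --> l -> (\forall n \near \oo, av (u n - c) <= M) -> av (l - c) <= M.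
Proof.
move=> ul uM.
have : (fun n => u n - c) @ \oo --> l - c.
  by apply: padic_cvgD => //; exact: padic_cvg_cst.
move/padic_cvg_abs => ulc.
exact: cvgr_to_le ulc uM.
Qed.

Lemma padic_cvgV u (l : C) :
  l != 0 -> u @ \oo --> l -> (fun n => (u n)^-1) @ \oo --> l^-1.
Proof.
move=> l0 ul; apply/padic_cvgP.
have al0 : av l != 0 by rewrite padic_abs_eq0.
have aul := padic_cvg_abs ul.
have u0 : \forall n \near \oo, u n != 0.
  have l2 : 0 < av l by rewrite padic_abs_gt0.
  near=> n; rewrite -padic_abs_gt0; near: n.
  exact: cvgr_gt aul _ l2.
apply: (@cvg_trans _ ((fun n => av (u n - l) * ((av (u n))^-1 * (av l)^-1)) @ \oo)).
  apply: near_eq_cvg; near=> n.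
  have un0 : u n != 0 by near: n.
  have -> : (u n)^-1 - l^-1 = (l - u n) * ((u n)^-1 * l^-1) by field; apply/andP.
  by rewrite !padic_absM !padic_absV padic_abs_distC.
rewrite -(mul0r ((av l)^-1 * (av l)^-1)).
apply: cvgM; first exact/padic_cvgP.
by apply: cvgM; [exact: cvgV|exact: cvg_cst].
Unshelve. all: by end_near.
Qed.

End AbsoluteValue.
Arguments padic_cvg_cst {R p C} l.

(** * Series dominated by a geometric progression *)

Section Series.
Context {R : realType} {p : nat} {C : padicFieldType R p}.
Context (C_complete : forall F : set_system C, ProperFilter F -> cauchy F -> cvg F).
Local Notation av := (@padic_abs R p C).

Definition geometrically_bounded (f : nat -> C) (B t : R) :=
  [/\ 0 <= B, 0 <= t, t < 1 & forall k, av (f k) <= B * t ^+ k].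

(** By ultrametricity a sum is no larger than its largest term, and the
    bounds on the terms decrease. *)
Lemma geometrically_bounded_sum f B t m n : geometrically_bounded f B t ->
  av (\sum_(m <= k < n) f k) <= B * t ^+ m.
Proof.
case=> B0 t0 t1 fB; apply: padic_abs_sum_le; first by rewrite mulr_ge0 ?exprn_ge0.
move=> k /andP[mk _]; apply: le_trans (fB k) _.
by rewrite ler_wpM2l // ler_wiXn2l // ltW.
Qed.

Lemma cvg_geometric0 (B t : R) : 0 <= t -> t < 1 -> B * t ^+ k @[k --> \oo] --> 0.
Proof.
move=> t0 t1; rewrite -[0](mulr0 B); apply: cvgM; first exact: cvg_cst.
by apply: cvg_expr; rewrite ger0_norm.
Qed.

Lemma geometrically_bounded_near f B t (e : R) : geometrically_bounded f B t ->
  0 < e -> \forall m \near \oo, B * t ^+ m < e.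
Proof.
case=> B0 t0 t1 _ e0.
exact: cvgr_lt (cvg_geometric0 B t0 t1) _ e0.
Qed.

Lemma padic_cvg_series f B t : geometrically_bounded f B t ->
  series f @ \oo --> limn (series f).
Proof.
move=> fB; apply: C_complete; apply: cauchy_exP => e e0.
have [K _ KB] := geometrically_bounded_near fB e0.
exists (series f K); exists K => // n /= Kn.
change (av (series f K - series f n) < e).
rewrite padic_abs_distC /series /= (big_cat_nat (n := K)) //= addrAC subrr add0r.
exact: le_lt_trans (geometrically_bounded_sum _ _ fB) (KB K (leqnn K)).
Qed.

Lemma padic_series_tail f (l : C) m (M : R) : series f @ \oo --> l -> 0 <= M ->
  (forall k, (m <= k)%N -> av (f k) <= M) ->
  av (l - \sum_(0 <= k < m) f k) <= M.
Proof.
move=> fl M0 fM; apply: (padic_lim_le fl).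
exists m => // n /= mn; rewrite /series /= (big_cat_nat (n := m)) //= addrAC
  subrr add0r.
apply: padic_abs_sum_le => // k /andP[mk _]; exact: fM.
Qed.

(** Dominated convergence for series (Tannery's theorem), with a number of
    terms [a N] that grows with [N]: beyond a fixed rank [K] all tails are
    uniformly small, and the [K] first terms converge one by one. *)
Lemma padic_cvg_tannery (F : nat -> nat -> C) (g : nat -> C) (a : nat -> nat) B t :
  (forall N, geometrically_bounded (F N) B t) ->
  (forall k, F ^~ k @ \oo --> g k) -> (forall N, (N <= a N)%N) ->
  (fun N => \sum_(0 <= k < a N) F N k) @ \oo --> limn (series g).
Proof.
move=> FB Fg a_ge.
have gB : geometrically_bounded g B t.
  case: (FB 0%N) => B0 t0 t1 _; split=> // k; rewrite -[g k]subr0.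
  apply: (padic_lim_le (Fg k)); apply: nearW => N; rewrite subr0.
  by case: (FB N).
have [B0 t0 t1 g_le] := gB.
apply/padic_cvgP/cvgrPdistC_lt => e e0.
have [K _ KB] := geometrically_bounded_near gB e0.
have tailg : av (limn (series g) - \sum_(0 <= k < K) g k) < e.
  apply: le_lt_trans (KB K (leqnn K)).
  apply: padic_series_tail; first exact: padic_cvg_series gB.
    by rewrite mulr_ge0 ?exprn_ge0.
  move=> k Kk; apply: le_trans (g_le k) _.
  by rewrite ler_wpM2l // ler_wiXn2l // ltW.
have /padic_cvgP/cvgrPdistC_lt/(_ e e0) headF :
    (fun N => \sum_(0 <= k < K) F N k) @ \oo --> \sum_(0 <= k < K) g k.
  by apply: padic_cvg_sum => k; exact: Fg.
near=> N.
have KN : (K <= a N)%N by apply: leq_trans (a_ge N); near: N; exists K.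
rewrite subr0 ger0_norm ?padic_abs_ge0 //.
have tailF : av (\sum_(K <= k < a N) F N k) < e.
  exact: le_lt_trans (geometrically_bounded_sum _ _ (FB N)) (KB K (leqnn K)).
have headN : av (\sum_(0 <= k < K) F N k - \sum_(0 <= k < K) g k) < e.
  by rewrite -[ltLHS]ger0_norm ?padic_abs_ge0 // -[X in `|X|]subr0; near: N.
rewrite (big_cat_nat (n := K)) //=.
set x := \sum_(0 <= k < K) F N k in headN *;
  set y := \sum_(K <= k < a N) _ in tailF *.
set s := \sum_(0 <= k < K) g k in headN tailg; set l := limn _ in tailg *.
have -> : x + y - l = (x - s) + (y + (s - l)) by ring.
apply: le_lt_trans (padic_absD _ _) _; rewrite gt_max headN /=.
by apply: le_lt_trans (padic_absD _ _) _; rewrite gt_max tailF padic_abs_distC.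
Unshelve. all: by end_near.
Qed.

End Series.

(** * Size of integers and of factorials *)

(** Legendre's bound (p - 1) v_p(n!) <= n - 1.  The weaker bound by [n] would
    not do: it is the bound by [n - 1] that keeps exp z in the open disc of
    radius p^(-1/(p-1)) around 1 where log is injective. *)
Lemma leq_logn_fact p n : prime p -> (0 < n)%N ->
  ((p.-1 * logn p n`!).+1 <= n)%N.
Proof.
move=> p_prime n0; have p1 := prime_gt1 p_prime.
have /andP[lepn ltnp] := trunc_log_bounds p1 n0.
set K := trunc_log p n in lepn ltnp.
have Kn : (K <= n)%N by rewrite (leq_trans (ltnW (ltn_expl K p1))).
have tail0 : (\sum_(K.+1 <= k < n.+1) n %/ p ^ k = 0)%N.
  rewrite big_nat_cond big1 // => i /andP[/andP[Ki _] _]; rewrite divn_small //.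
  by rewrite (leq_trans ltnp) // leq_exp2l.
rewrite logn_fact // (big_cat_nat (n := K.+1)) //= tail0 addn0.
(* The remainder term makes the bound telescope; it is positive for M = K. *)
have partial M : (p.-1 * (\sum_(1 <= k < M.+1) n %/ p ^ k) + n %/ p ^ M <= n)%N.
  elim: M => [|M IH]; first by rewrite big_geq // muln0 add0n expn0 divn1.
  rewrite big_nat_recr //= mulnDr -addnA.
  apply: leq_trans IH; rewrite leq_add2l -mulSnr prednK ?prime_gt0 //.
  by rewrite expnSr divnMA mulnC leq_trunc_div.
apply: leq_trans (partial K).
by rewrite -addn1 leq_add2l divn_gt0 // expn_gt0 prime_gt0.
Qed.

Definition exp_radius (R : realType) (p : nat) : R := p%:R `^ (- (p%:R - 1)^-1).

Section Size.
Context {R : realType} {p : nat} (p_prime : prime p) {C : padicFieldType R p}.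
Local Notation av := (@padic_abs R p C).
Local Notation rho := (exp_radius R p).

Let p_gt0 : 0 < p%:R :> R. Proof. by rewrite ltr0n prime_gt0. Qed.

Lemma exp_radius_gt0 : 0 < rho. Proof. exact: powR_gt0. Qed.

Lemma exp_radius_le1 : rho <= 1.
Proof.
have p1 : 1 <= p%:R :> R by rewrite ler1n prime_gt0.
rewrite -(powRr0 p%:R); apply: ler_powR => //.
by rewrite oppr_le0 invr_ge0 subr_ge0.
Qed.

Lemma exp_radiusX : rho ^+ p.-1 = p%:R^-1.
Proof.
have p1 : p%:R - 1 != 0 :> R.
  by rewrite subr_eq0 pnatr_eq1; have := prime_gt1 p_prime; lia.
rewrite -powR_mulrn ?ltW ?exp_radius_gt0 // -powRrM.
rewrite -subn1 natrB ?prime_gt0 //.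
by rewrite mulNr mulVf // powR_inv1 // ltW.
Qed.

(** A Bezout relation [a * m = b * p + 1] exhibits [a * m] as close to 1, so
    that [m] cannot be small. *)
Lemma padic_abs_coprime m : coprime p m -> av m%:R = 1.
Proof.
move=> pm; apply/eqP; rewrite eq_le padic_abs_nat /= leNgt; apply/negP => m1.
have m0 : (0 < m)%N.
  case: m pm {m1} => // /eqP; rewrite gcdn0 => pE.
  by have := prime_gt1 p_prime; rewrite pE.
case: (egcdnP p m0) => a b ab _; rewrite gcdnC (eqP pm) in ab.
have bp : av (b * p)%:R < 1.
  rewrite natrM padic_absM padic_abs_p.
  apply: le_lt_trans (ler_wpM2r _ (padic_abs_nat b)) _.
    by rewrite invr_ge0 ltW.
  by rewrite mul1r invf_lt1 // ltr1n prime_gt1.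
have : av (a * m)%:R = 1.
  apply: padic_absB_near1; rewrite ab natrD opprD addrCA subrr addr0.
  by rewrite padic_absN.
rewrite natrM padic_absM => /eqP; apply/negP; rewrite lt_eqF //.
apply: le_lt_trans (ler_wpM2r _ (padic_abs_nat a)) _; first exact: padic_abs_ge0.
by rewrite mul1r.
Qed.

Lemma padic_abs_natE m : (0 < m)%N -> av m%:R = p%:R^-1 ^+ logn p m.
Proof.
move=> m0; have [m' pm' {1}->] := pfactor_coprime p_prime m0.
by rewrite natrM padic_absM padic_abs_coprime // mul1r natrX padic_absX padic_abs_p.
Qed.

Lemma padic_natr_neq0 m : (0 < m)%N -> m%:R != 0 :> C.
Proof.
by move=> m0; rewrite -padic_abs_gt0 padic_abs_natE // exprn_gt0 // invr_gt0.
Qed.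

Lemma exp_radius_le_fact k : rho ^+ k <= av k.+1`!%:R.
Proof.
rewrite padic_abs_natE ?fact_gt0 // -exp_radiusX -exprM.
apply: ler_wiXn2l; rewrite ?exp_radius_le1 ?(ltW exp_radius_gt0) //.
by have := leq_logn_fact p_prime (ltn0Sn k).
Qed.

Lemma exp_radius_le_nat k : rho ^+ k <= av k.+1%:R.
Proof.
apply: le_trans (exp_radius_le_fact k) _; rewrite factS natrM padic_absM.
by rewrite ler_piMr ?padic_abs_ge0 ?padic_abs_nat.
Qed.

(** Used with [c] equal to [k.+1] for the logarithm, to [k.+1`!] for the
    exponential: the terms of both series decrease geometrically, the first one
    being of size [av z]. *)
Lemma padic_abs_divided_power (z c : C) k : rho ^+ k <= av c ->
  av (z ^+ k.+1 / c) <= av z * (av z / rho) ^+ k.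
Proof.
move=> kc; rewrite padic_abs_div padic_absX exprS -mulrA ler_wpM2l
  ?padic_abs_ge0 //.
rewrite expr_div_n ler_wpM2l ?exprn_ge0 ?padic_abs_ge0 //.
have rk : 0 < rho ^+ k by rewrite exprn_gt0 ?exp_radius_gt0.
by rewrite lef_pV2 // posrE (lt_le_trans rk).
Qed.

Lemma padic_cvg_pX : (fun N => (p ^ N)%:R : C) @ \oo --> (0 : C).
Proof.
apply: (@padic_cvg_le _ _ _ _ _ (fun N => 1 * p%:R^-1 ^+ N)).
  by move=> N; rewrite subr0 natrX padic_absX padic_abs_p mul1r.
apply: cvg_geometric0; first by rewrite invr_ge0 ltW.
by rewrite invf_lt1 // ltr1n prime_gt1.
Qed.

End Size.

(** * The exponential *)

Section Exponential.
Context {R : realType} {p : nat} (p_prime : prime p) {C : padicFieldType R p}.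
Context (C_complete : forall F : set_system C, ProperFilter F -> cauchy F -> cvg F).
Local Notation av := (@padic_abs R p C).
Local Notation rho := (exp_radius R p).

Let rho_gt0 : 0 < rho. Proof. exact: exp_radius_gt0. Qed.

Lemma radius_ratio (z : C) : av z < rho -> 0 <= av z / rho < 1.
Proof.
by move=> zr; rewrite ltr_pdivrMr // mul1r zr divr_ge0 ?padic_abs_ge0 ?ltW.
Qed.

Lemma exp_term_le (z : C) k : av z < rho ->
  av (z ^+ k.+1 / k.+1`!%:R) <= av z * (av z / rho) ^+ k.
Proof. by move=> zr; apply/padic_abs_divided_power/exp_radius_le_fact. Qed.

Lemma exp_term_bounded (z : C) : av z < rho ->
  geometrically_bounded (fun k => z ^+ k / k`!%:R) 1 (av z / rho).
Proof.
move=> zr; have /andP[t0 t1] := radius_ratio zr; split=> // -[|k].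
  by rewrite expr0 divr1 padic_abs1 mulr1.
apply: le_trans (exp_term_le k zr) _; rewrite mul1r exprS ler_wpM2r ?exprn_ge0 //.
by rewrite ler_pdivlMr // ler_piMr ?padic_abs_ge0 ?exp_radius_le1.
Qed.

Lemma padic_exp_cvg (z : C) : av z < rho ->
  series (fun k => z ^+ k / k`!%:R) @ \oo --> padic_exp z.
Proof. by move=> zr; apply: (padic_cvg_series C_complete (exp_term_bounded zr)).
Qed.

Lemma padic_expB1_le (z : C) : av z < rho -> av (padic_exp z - 1) <= av z.
Proof.
move=> zr; have /andP[t0 t1] := radius_ratio zr.
have := @padic_series_tail _ _ _ _ _ 1 (av z) (padic_exp_cvg zr) (padic_abs_ge0 z).
rewrite big_nat1 expr0 divr1; apply => -[|k] // _.
by apply: le_trans (exp_term_le k zr) _; rewrite ler_piMr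
  ?padic_abs_ge0 // exprn_ile1 // ltW.
Qed.

(** The exponential is 1 + z to first order, with a quadratic error. *)
Lemma padic_expB1B_le (z : C) : av z < rho ->
  av (padic_exp z - 1 - z) <= av z * (av z / rho).
Proof.
move=> zr; have /andP[t0 t1] := radius_ratio zr.
have M0 : 0 <= av z * (av z / rho) by rewrite mulr_ge0 ?padic_abs_ge0.
have := @padic_series_tail _ _ _ _ _ 2 _ (padic_exp_cvg zr) M0.
rewrite big_nat_recr //= big_nat1 expr0 expr1 !divr1 opprD addrA;
  apply => -[|[|k]] // _.
apply: le_trans (exp_term_le _ zr) _; rewrite ler_wpM2l ?padic_abs_ge0 //.
by rewrite exprS ler_piMr // exprn_ile1 // ltW.
Qed.

Lemma padic_exp_near1 (z : C) : av z < rho -> av (1 - padic_exp z) < rho.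
Proof. by move=> zr; rewrite padic_abs_distC (le_lt_trans (padic_expB1_le zr)). Qed.

Lemma sum_triangle (F : nat -> nat -> C) n :
  \sum_(0 <= m < n) \sum_(0 <= i < m.+1) F i (m - i)%N =
  \sum_(0 <= i < n) \sum_(0 <= j < n - i) F i j.
Proof.
elim: n => [|n IH]; first by rewrite !big_geq.
rewrite big_nat_recr //= IH.
transitivity (\sum_(0 <= i < n.+1) (\sum_(0 <= j < n - i) F i j + F i (n - i)%N)).
  by rewrite big_split /= [X in _ = X + _]big_nat_recr //= subnn
    [X in _ + X + _]big_geq // addr0.
by apply: eq_big_nat => i /andP[_]; rewrite ltnS => ?;
  rewrite subSn // big_nat_recr.
Qed.

Lemma exp_term_convolution (a b : C) m :
  (a + b) ^+ m / m`!%:R =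
  \sum_(0 <= i < m.+1) (a ^+ i / i`!%:R) * (b ^+ (m - i) / (m - i)`!%:R).
Proof.
rewrite addrC exprDn big_mkord mulr_suml; apply: eq_bigr => i _.
have im : (i <= m)%N by rewrite -ltnS.
have f0 k : k`!%:R != 0 :> C by rewrite (padic_natr_neq0 p_prime) ?fact_gt0.
rewrite -(bin_fact im) !natrM -mulr_natr.
have : 'C(m, i)%:R != 0 :> C by rewrite (padic_natr_neq0 p_prime) ?bin_gt0.
have := f0 i; have := f0 (m - i)%N.
move: (_%:R) (_%:R) (_%:R) => x y z; move=> x0 y0 z0.
by field; rewrite x0 y0.
Qed.

(** The product of the [n]-th partial sums of exp a and exp b differs from the
    [n]-th partial sum of exp (a + b) by terms of total degree at least [n], all
    bounded by [t ^+ n]. *)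
Lemma padic_expD (a b : C) : av a < rho -> av b < rho ->
  padic_exp (a + b) = padic_exp a * padic_exp b.
Proof.
move=> ar br; have abr : av (a + b) < rho.
  by rewrite (le_lt_trans (padic_absD _ _)) // gt_max ar.
have := padic_cvgM (padic_exp_cvg ar) (padic_exp_cvg br).
apply: padic_cvg_unique.
pose t := Num.max (av a / rho) (av b / rho).
have /andP[a0 a1] := radius_ratio ar; have /andP[b0 b1] := radius_ratio br.
have t0 : 0 <= t by rewrite le_max a0.
have t1 : t < 1 by rewrite gt_max a1.
have term_le (z : C) k : av z < rho -> av z / rho <= t ->
    av (z ^+ k / k`!%:R) <= t ^+ k.
  move=> zr zt; have [_ _ _ /(_ k)] := exp_term_bounded zr.
  rewrite mul1r => /le_trans; apply.
  by apply: lerXn2r => //; rewrite nnegrE divr_ge0 ?padic_abs_ge0 ?ltW.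
have {term_le} [aB bB] : (forall k, av (a ^+ k / k`!%:R) <= t ^+ k) /\
    (forall k, av (b ^+ k / k`!%:R) <= t ^+ k).
  by split=> k; apply: term_le; rewrite // le_max lexx ?orbT.
have diff : (fun n => series (fun k => a ^+ k / k`!%:R) n *
      series (fun k => b ^+ k / k`!%:R) n -
    series (fun k => (a + b) ^+ k / k`!%:R) n) @ \oo --> (0 : C).
  apply: (@padic_cvg_le _ _ _ _ _ (fun n => 1 * t ^+ n));
    last exact: cvg_geometric0.
  move=> n; rewrite subr0 mul1r /series /=.
  under [X in _ - X]eq_bigr do rewrite exp_term_convolution.
  rewrite (sum_triangle (fun i j => (a ^+ i / i`!%:R) * (b ^+ j / j`!%:R))).
  rewrite mulr_suml -sumrB; apply: padic_abs_sum_le; first exact: exprn_ge0.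
  move=> i /andP[_ iltn].
  rewrite (big_cat_nat (n := n - i)) ?leq_subr //= mulrDr -mulr_sumr
    addrAC subrr add0r.
  rewrite mulr_sumr; apply: padic_abs_sum_le; first exact: exprn_ge0.
  move=> j /andP[nij _]; rewrite padic_absM.
  apply: le_trans (ler_pM (padic_abs_ge0 _) (padic_abs_ge0 _) (aB i) (bB j)) _.
  rewrite -exprD ler_wiXn2l ?(ltW t1) // -leq_subLR //.
have := padic_cvgD diff (padic_exp_cvg abr).
rewrite add0r.
by under eq_fun do rewrite subrK.
Qed.
End Exponential.

(** * The logarithm *)

Section Logarithm.
Context {R : realType} {p : nat} (p_prime : prime p) {C : padicFieldType R p}.
Context (C_complete : forall F : set_system C, ProperFilter F -> cauchy F -> cvg F).
Local Notation av := (@padic_abs R p C).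
Local Notation rho := (exp_radius R p).

Let rho_gt0 : 0 < rho. Proof. exact: exp_radius_gt0. Qed.

Let natr_neq0 m : (0 < m)%N -> m%:R != 0 :> C. Proof. exact: padic_natr_neq0. Qed.

(** The common domain of the bases Q: log is injective on it, with values in
    the disc of convergence of exp. *)
Definition near1 : set C := [set Q | av (1 - Q) < rho].

Lemma near1_abs Q : near1 Q -> av Q = 1.
Proof. by move=> Q1; apply/padic_absB_near1/(lt_le_trans Q1)/exp_radius_le1. Qed.

Lemma near1_neq0 Q : near1 Q -> Q != 0.
Proof. by move=> /near1_abs Q1; rewrite -padic_abs_gt0 Q1. Qed.

Lemma near1_1 : near1 1.
Proof. by rewrite /near1 /= subrr padic_abs0. Qed.

Lemma near1M P Q : near1 P -> near1 Q -> near1 (P * Q).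
Proof.
move=> P1 Q1; have -> : P * Q = 1 - ((1 - P) + P * (1 - Q)) by ring.
rewrite /near1 /= subKr (le_lt_trans (padic_absD _ _)) // gt_max P1 /=.
by rewrite padic_absM (near1_abs P1) mul1r.
Qed.

Lemma near1V Q : near1 Q -> near1 Q^-1.
Proof.
move=> Q1; have Q0 := near1_neq0 Q1.
have -> : Q^-1 = 1 - (Q - 1) / Q by field.
by rewrite /near1 /= subKr padic_abs_div (near1_abs Q1) divr1 padic_abs_distC.
Qed.

Lemma near1X Q m : near1 Q -> near1 (Q ^+ m).
Proof.
by move=> Q1; elim: m => [|m IH]; rewrite ?expr0 ?exprS;
  [exact: near1_1|exact: near1M].
Qed.

Lemma near1Xz Q (b : int) : near1 Q -> near1 (Q ^ b).
Proof.
by case: b => m Q1; rewrite ?NegzE -?exprnN -?exprnP; [|apply: near1V];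
  exact: near1X.
Qed.

(** Stated for arbitrary integral coefficients to serve both the logarithmic
    series and the binomial sums that converge to it. *)
Lemma log_term_bounded Q (c : nat -> C) : near1 Q -> (forall k, av (c k) <= 1) ->
  geometrically_bounded (fun k => c k * (Q - 1) ^+ k.+1 / k.+1%:R)
    (av (1 - Q)) (av (1 - Q) / rho).
Proof.
move=> Q1 c1; have /andP[t0 t1] := radius_ratio p_prime Q1; split=> // [|k].
  exact: padic_abs_ge0.
rewrite -mulrA padic_absM (padic_abs_distC 1).
apply: le_trans (ler_wpM2r (padic_abs_ge0 _) (c1 k)) _; rewrite mul1r.
exact/padic_abs_divided_power/exp_radius_le_nat.
Qed.

Lemma log_term_le Q k : near1 Q ->
  av ((-1) ^+ k * (Q - 1) ^+ k.+1 / k.+1%:R) <= av (1 - Q) *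
    (av (1 - Q) / rho) ^+ k.
Proof.
move=> Q1; have sign_le i : av ((-1) ^+ i) <= 1 by rewrite padic_abs_sign.
by case: (log_term_bounded Q1 sign_le).
Qed.

Lemma padic_log_cvg Q : near1 Q ->
  series (fun k => (-1) ^+ k * (Q - 1) ^+ k.+1 / k.+1%:R) @ \oo --> padic_log Q.
Proof.
move=> Q1; apply: (padic_cvg_series C_complete).
by apply: log_term_bounded => // k; rewrite padic_abs_sign.
Qed.

(** To first order log Q is Q - 1, and the error is strictly smaller than Q - 1
    when Q is not 1; this is why log has a trivial kernel on the disc. *)
Lemma padic_logB_le Q : near1 Q ->
  av (padic_log Q - (Q - 1)) <= av (1 - Q) * (av (1 - Q) / rho).
Proof.
move=> Q1; have /andP[t0 t1] := radius_ratio p_prime Q1.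
have M0 : 0 <= av (1 - Q) * (av (1 - Q) / rho) by rewrite mulr_ge0 ?padic_abs_ge0.
have := @padic_series_tail _ _ _ _ _ 1 _ (padic_log_cvg Q1) M0.
rewrite big_nat1 expr0 mul1r expr1 divr1; apply => -[|k] // _.
apply: le_trans (log_term_le k.+1 Q1) _; rewrite ler_wpM2l ?padic_abs_ge0 //.
by rewrite exprS ler_piMr // exprn_ile1 // ltW.
Qed.

Lemma padic_log_lt Q : near1 Q -> av (padic_log Q) < rho.
Proof.
move=> Q1; have /andP[t0 t1] := radius_ratio p_prime Q1.
apply: (le_lt_trans _ Q1); rewrite -[padic_log Q](subrK (Q - 1)) padic_absD_le //.
  by apply: le_trans (padic_logB_le Q1) _; rewrite ler_piMr ?padic_abs_ge0 // ltW.
by rewrite padic_abs_distC.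
Qed.

Lemma padic_log_eq0 Q : near1 Q -> padic_log Q = 0 -> Q = 1.
Proof.
move=> Q1 l0; have /andP[t0 t1] := radius_ratio p_prime Q1.
have := padic_logB_le Q1; rewrite l0 sub0r opprB => le1.
apply/eqP; rewrite eq_sym -subr_eq0 -padic_abs_eq0 eq_le padic_abs_ge0 andbT.
rewrite leNgt; apply/negP => gt0.
by move: le1; rewrite leNgt -{3}[av (1 - Q)]mulr1 ltr_pM2l // t1.
Qed.

(** The binomial polynomials are continuous and p^N tends to 0, so the limit is
    the binomial coefficient of -1 over k.  The proof is an induction on
    C(p^N - 1, k+1) = (p^N / (k+1) - 1) C(p^N - 1, k). *)
Lemma padic_cvg_bin k :
  (fun N => 'C((p ^ N).-1, k)%:R : C) @ \oo --> ((-1) ^+ k : C).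
Proof.
elim: k => [|k IH].
  by under eq_fun do rewrite bin0; exact: padic_cvg_cst.
have -> : (fun N => 'C((p ^ N).-1, k.+1)%:R : C) =
    (fun N => ((p ^ N)%:R / k.+1%:R + -1) * 'C((p ^ N).-1, k)%:R).
  apply/funext => N; have P0 : (0 < p ^ N)%N by rewrite expn_gt0 prime_gt0.
  have := mul_bin_diag (p ^ N) k; case: (p ^ N)%N P0 => // m _ /=.
  rewrite binS => /(congr1 (fun x => x%:R : C)); rewrite !natrM natrD => E.
  apply: (mulfI (natr_neq0 (ltn0Sn k))).
  rewrite mulrA mulrDr mulrCA divff ?natr_neq0 // mulr1 mulrN1 mulrDl E; ring.
rewrite exprS; apply: padic_cvgM IH.
have := padic_cvgD (padic_cvgM (padic_cvg_pX p_prime) (padic_cvg_cst k.+1%:R^-1))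
  (padic_cvg_cst (-1 : C)).
by rewrite mul0r add0r.
Qed.

(** The logarithm is the derivative at 0 of the map s |-> Q^s.  By the binomial
    formula the quotient is the sum of the terms
    C(p^N - 1, k) (Q - 1)^(k+1) / (k+1), which converge to those of the
    logarithmic series and are dominated by a geometric progression. *)
Lemma padic_log_lim Q : near1 Q ->
  (fun N => (Q ^+ (p ^ N) - 1) / (p ^ N)%:R) @ \oo --> padic_log Q.
Proof.
move=> Q1.
have -> : (fun N => (Q ^+ (p ^ N) - 1) / (p ^ N)%:R) =
  (fun N => \sum_(0 <= k < p ^ N)
    'C((p ^ N).-1, k)%:R * (Q - 1) ^+ k.+1 / k.+1%:R).
  apply/funext => N; have P0 : (0 < p ^ N)%N by rewrite expn_gt0 prime_gt0.
  rewrite -{1}[Q](subrK 1) [_ + 1]addrC exprDn big_ord_recl expr1n bin0 expr0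
    mulr1 /=.
  rewrite addrAC subrr add0r mulr_suml big_mkord; apply: eq_bigr => k _.
  rewrite expr1n mul1r /bump add1n -[_ *+ _]mulr_natl.
  have /(congr1 (fun x => x%:R : C)) := mul_bin_diag (p ^ N) k.
  rewrite !natrM => E.
  have PC := natr_neq0 P0; have kC := natr_neq0 (ltn0Sn k).
  have -> : 'C(p ^ N, k.+1)%:R = (p ^ N)%:R * 'C((p ^ N).-1, k)%:R / k.+1%:R :> C.
    by rewrite E mulrC mulKf.
  by field; rewrite nat1r kC PC.
apply: (padic_cvg_tannery C_complete (fun N => log_term_bounded Q1 (fun k =>
  padic_abs_nat _))).
  move=> k; apply: padic_cvgM; last exact: padic_cvg_cst.
  by apply: padic_cvgM; [exact: padic_cvg_bin|exact: padic_cvg_cst].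
by move=> N; rewrite ltnW // ltn_expl // prime_gt1.
Qed.

Lemma padic_cvg_pow1 Q : near1 Q -> (fun N => Q ^+ (p ^ N)) @ \oo --> (1 : C).
Proof.
move=> Q1; have P0 N : (p ^ N)%:R != 0 :> C by rewrite natr_neq0 // expn_gt0
  prime_gt0.
have := padic_cvgD (padic_cvgM (padic_log_lim Q1) (padic_cvg_pX p_prime))
  (padic_cvg_cst (1 : C)).
rewrite mulr0 add0r.
by under eq_fun do rewrite divfK // subrK.
Qed.

(** (P Q)^m - 1 = (P^m - 1) Q^m + (Q^m - 1), and Q^m tends to 1 along m = p^N. *)
Lemma padic_logM P Q : near1 P -> near1 Q ->
  padic_log (P * Q) = padic_log P + padic_log Q.
Proof.
move=> P1 Q1.
apply: padic_cvg_unique (padic_log_lim (near1M P1 Q1)) _.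
have -> : (fun N => ((P * Q) ^+ (p ^ N) - 1) / (p ^ N)%:R) = (fun N =>
    (P ^+ (p ^ N) - 1) / (p ^ N)%:R * Q ^+ (p ^ N) + (Q ^+ (p ^ N) - 1) / (p ^
      N)%:R).
  by apply/funext => N; rewrite exprMn; ring.
rewrite -[padic_log P]mulr1.
exact: padic_cvgD (padic_cvgM (padic_log_lim P1) (padic_cvg_pow1 Q1))
  (padic_log_lim Q1).
Qed.

Lemma padic_log1 : padic_log (1 : C) = 0.
Proof.
by have /(congr1 (fun x => x - padic_log 1)) := padic_logM near1_1 near1_1;
  rewrite mulr1 addrK subrr.
Qed.

Lemma padic_logX Q m : near1 Q -> padic_log (Q ^+ m) = m%:R * padic_log Q.
Proof.
move=> Q1; elim: m => [|m IH]; first by rewrite expr0 padic_log1 mul0r.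
by rewrite exprS padic_logM ?IH; [rewrite -addn1 natrD mulrDl mul1r addrC|
  exact: Q1|exact: near1X].
Qed.

Lemma padic_logV Q : near1 Q -> padic_log Q^-1 = - padic_log Q.
Proof.
move=> Q1; apply/eqP; rewrite -addr_eq0 -padic_logM //; last exact: near1V.
by rewrite mulVf ?padic_log1 // near1_neq0.
Qed.

Lemma padic_logXz Q (b : int) : near1 Q -> padic_log (Q ^ b) = b%:~R * padic_log Q.
Proof.
move=> Q1; case: b => m; first by rewrite -exprnP padic_logX.
rewrite NegzE -exprnN padic_logV ?padic_logX //; last exact: near1X.
by rewrite mulrNz mulNr.
Qed.

Lemma padic_exp0 : padic_exp (0 : C) = 1.
Proof.
have r0 : av 0 < rho by rewrite padic_abs0.
have := padic_expB1_le p_prime C_complete r0; rewrite padic_abs0.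
by move=> /(conj (padic_abs_ge0 _))/andP/le_anti/eqP;
  rewrite eq_sym padic_abs_eq0 subr_eq0 => /eqP.
Qed.

Lemma padic_expMn (z : C) m : av z < rho -> padic_exp (m%:R * z) = padic_exp z ^+ m.
Proof.
move=> zr; elim: m => [|m IH]; first by rewrite mul0r padic_exp0 expr0.
rewrite -addn1 natrD mulrDl mul1r padic_expD // ?IH ?addn1 ?exprSr //.
rewrite padic_absM; apply: le_lt_trans zr.
by rewrite ler_piMl ?padic_abs_ge0 ?padic_abs_nat.
Qed.

(** exp (z)^(p^N) = exp (p^N z) = 1 + p^N z up to a quadratic error, so the
    quotients of [padic_log_lim] tend to z. *)
Lemma padic_expK (z : C) : av z < rho -> padic_log (padic_exp z) = z.
Proof.
move=> zr; have ez1 : near1 (padic_exp z) by exact: padic_exp_near1.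
have /andP[t0 t1] := radius_ratio p_prime zr.
apply: padic_cvg_unique (padic_log_lim ez1) _.
apply: (@padic_cvg_le _ _ _ _ _ (fun N => (av z * (av z / rho)) *
  (p%:R^-1) ^+ N)); last first.
  apply: cvg_geometric0; first by rewrite invr_ge0.
  by rewrite invf_lt1 ?ltr1n ?ltr0n ?prime_gt1 ?prime_gt0.
move=> N; have P0 : (p ^ N)%:R != 0 :> C by rewrite natr_neq0 // expn_gt0 prime_gt0.
have aP : av (p ^ N)%:R = p%:R^-1 ^+ N by rewrite natrX padic_absX padic_abs_p.
have Pr : av ((p ^ N)%:R * z) < rho.
  rewrite padic_absM; apply: le_lt_trans zr.
  by rewrite ler_piMl ?padic_abs_ge0 ?padic_abs_nat.
rewrite -padic_expMn // -[X in _ / _ - X](mulfK P0) -mulrBl [z * _]mulrC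
  padic_abs_div.
rewrite ler_pdivrMr ?padic_abs_gt0 //.
apply: le_trans (padic_expB1B_le p_prime C_complete Pr) _.
by rewrite padic_absM aP -!mulrA; nra.
Qed.

(** Both sides have the same logarithm, and log is injective on the disc. *)
Lemma padic_logK Q : near1 Q -> padic_exp (padic_log Q) = Q.
Proof.
move=> Q1; have lr := padic_log_lt Q1.
have e1 : near1 (padic_exp (padic_log Q)) by exact: padic_exp_near1.
have Q0 := near1_neq0 Q1.
have : padic_log (padic_exp (padic_log Q) / Q) = 0.
  by rewrite padic_logM ?padic_logV ?padic_expK ?subrr //; exact: near1V.
move=> /(padic_log_eq0 (near1M e1 (near1V Q1))) /(congr1 ( *%R^~ Q)).
by rewrite divfK // mul1r.
Qed.
End Logarithm.

(** * Volkenborn integrals of exponentials *)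

Section Volkenborn.
Context {R : realType} {p : nat} (p_prime : prime p) {C : padicFieldType R p}.
Context (C_complete : forall F : set_system C, ProperFilter F -> cauchy F -> cvg F).
Local Notation av := (@padic_abs R p C).
Local Notation rho := (exp_radius R p).

Lemma padic_expN (z : C) : av z < rho -> padic_exp (- z) = (padic_exp z)^-1.
Proof.
move=> zr; apply: (mulfI (near1_neq0 p_prime (padic_exp_near1 p_prime C_complete
  zr))).
rewrite -padic_expD ?padic_absN // subrr padic_exp0 //.
by rewrite divff // (near1_neq0 p_prime (padic_exp_near1 p_prime C_complete zr)).
Qed.

Lemma padic_expMz (z : C) (b : int) : av z < rho ->
  padic_exp (b%:~R * z) = padic_exp z ^ b.
Proof.
move=> zr; case: b => m; first by rewrite padic_expMn.
rewrite NegzE mulrNz mulNr padic_expN ?padic_expMn //.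
rewrite padic_absM; apply: le_lt_trans zr.
by rewrite ler_piMl ?padic_abs_ge0 ?padic_abs_nat.
Qed.

(** The disc contains no root of unity except 1, as log would vanish there. *)
Lemma near1_exprz_neq1 (Q : C) (b : int) :
  near1 Q -> Q != 1 -> b != 0 -> Q ^ b != 1.
Proof.
move=> Q1 Qn1 b0; apply: contraNneq Qn1 => Qb1;
  apply/eqP/(padic_log_eq0 p_prime C_complete Q1).
have := padic_logXz p_prime C_complete b Q1;
  rewrite Qb1 (padic_log1 p_prime C_complete).
move/esym/eqP; rewrite mulf_eq0 => /orP[|/eqP //].
case: b b0 {Qb1} => m m0; rewrite ?NegzE ?mulrNz ?oppr_eq0 => /negPn.
  by rewrite (padic_natr_neq0 p_prime) // lt0n.
by rewrite (padic_natr_neq0 p_prime).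
Qed.

Lemma near1_exprn_neq1 (Q : C) m : near1 Q -> Q != 1 -> (0 < m)%N -> Q ^+ m != 1.
Proof. by move=> Q1 Qn1 m0; apply: (@near1_exprz_neq1 Q m); rewrite // -lt0n. Qed.

Lemma padic_pow_nat (Q : C) m : near1 Q -> padic_pow Q m%:R = Q ^+ m.
Proof.
by move=> Q1; rewrite /padic_pow padic_expMn ?padic_logK //; exact: padic_log_lt.
Qed.

Lemma padic_pow_dom (Q y : C) : near1 Q -> av y <= 1 -> av (y * padic_log Q) < rho.
Proof.
move=> Q1 y1; rewrite padic_absM; apply:
  le_lt_trans (padic_log_lt p_prime C_complete Q1).
by rewrite ler_piMl ?padic_abs_ge0.
Qed.

Lemma padic_powD (Q z y : C) : near1 Q -> av (z * padic_log Q) < rho -> av y <= 1 ->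
  padic_pow Q (z + y) = padic_pow Q z * padic_pow Q y.
Proof. by move=> Q1 zQ y1; rewrite /padic_pow mulrDl padic_expD // padic_pow_dom.
Qed.

Lemma padic_powMz (Q y : C) (b : int) : near1 Q -> av y <= 1 ->
  padic_pow Q (b%:~R * y) = padic_pow Q y ^ b.
Proof. by move=> Q1 y1; rewrite /padic_pow -mulrA padic_expMz //;
  exact: padic_pow_dom. Qed.

Lemma padic_pow_sum (Q : C) r (F : 'I_r -> C) : near1 Q -> (forall i,
  av (F i) <= 1) ->
  padic_pow Q (\sum_(i < r) F i) = \prod_(i < r) padic_pow Q (F i).
Proof.
move=> Q1 F1.
suff [] : av (\sum_(i < r) F i) <= 1 /\
    padic_pow Q (\sum_(i < r) F i) = \prod_(i < r) padic_pow Q (F i) by [].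
elim/big_rec2: _ => [|i y x _ [IH1 IH2]].
  by rewrite padic_abs0 ler01 /padic_pow mul0r (padic_exp0 p_prime C_complete).
split; first exact: padic_absD_le.
by rewrite padic_powD ?padic_pow_dom // IH2.
Qed.

Lemma padic_Zp_le1 (y : padic_Zp C) : av (val y) <= 1.
Proof. by have /set_mem[] := valP y. Qed.

(** The Volkenborn integral of Q^((b - 1) y) is [1 - Q] times this.  The value at
    [b = 0] is the p-adic limit of the other branch, as Q^b is 1 + b log Q up to
    a quadratic error in b. *)
Definition exp_mean (Q : C) (b : int) : C :=
  if b == 0 then - (padic_log Q)^-1 else b%:~R / (1 - Q ^ b).

(** The summands are the powers of [Q ^ (b + 1)].  When [b + 1] is not 0 the
    geometric sum leaves the quotient of (Q^(b+1))^(p^N) - 1 by Q^(p^N) - 1;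
    dividing both by p^N gives log (Q^(b+1)) / log Q = b + 1 in the limit. *)
Lemma volkenborn_sum_cvg (Q : C) (b : int) : near1 Q -> Q != 1 ->
  (fun N => (qbracket Q (p ^ N)%:R)^-1 *
    \sum_(0 <= y < p ^ N) padic_pow Q (val (padic_Zp_nat y :
      padic_Zp C)) ^ b * Q ^+ y)
  @ \oo --> (1 - Q) * exp_mean Q (b + 1).
Proof.
move=> Q1 Qn1; have Q0 := near1_neq0 p_prime Q1.
have l0 : padic_log Q != 0.
  by apply: contraNneq Qn1 => l0; apply/eqP/(padic_log_eq0 p_prime C_complete Q1).
have P0 N : (0 < p ^ N)%N by rewrite expn_gt0 prime_gt0.
have PC N : (p ^ N)%:R != 0 :> C by rewrite padic_natr_neq0.
have QP N : Q ^+ (p ^ N) - 1 != 0 by rewrite subr_eq0 near1_exprn_neq1.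
have Q1' : 1 - Q != 0 by rewrite subr_eq0 eq_sym.
have summand N : \sum_(0 <= y < p ^ N) padic_pow Q (val (padic_Zp_nat y :
  padic_Zp C)) ^ b * Q ^+ y
    = \sum_(y < p ^ N) (Q ^ (b + 1)) ^+ y.
  rewrite big_mkord; apply: eq_bigr => y _ /=; rewrite padic_pow_nat //.
  rewrite (exprnP Q y) (exprnP (Q ^ (b + 1)) y) !exprz_exp -expfzDr //;
    congr (_ ^ _); ring.
have inv_lim := padic_cvgV l0 (padic_log_lim p_prime C_complete Q1).
have PN N : 1 - Q ^+ (p ^ N) != 0 by rewrite -oppr_eq0 opprB.
have qbE N : (qbracket Q (p ^ N)%:R)^-1 = (1 - Q) / (1 - Q ^+ (p ^ N)).
  by rewrite /qbracket padic_pow_nat // invf_div.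
rewrite /exp_mean; case: eqP => [b0|/eqP b0].
  rewrite [X in X @ _ --> _](_ : _ =
      (fun N => - (1 - Q) * ((Q ^+ (p ^ N) - 1) / (p ^ N)%:R)^-1)).
    by rewrite mulrN -mulNr; exact: padic_cvgM (padic_cvg_cst _) inv_lim.
  apply/funext => N; rewrite summand qbE b0 expr0z.
  under eq_bigr do rewrite expr1n.
  rewrite sumr_const card_ord; field.
  by rewrite PN QP PC.
have Qb1 : Q ^ (b + 1) - 1 != 0 by rewrite subr_eq0 near1_exprz_neq1.
have := padic_cvgM (padic_cvgM (padic_cvg_cst ((1 - Q) / (1 - Q ^ (b + 1))))
  (padic_log_lim p_prime C_complete (near1Xz p_prime (b + 1) Q1))) inv_lim.
rewrite padic_logXz // mulrA mulfK // -mulrA [_^-1 * _]mulrC.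
rewrite [X in X @ _ --> _ -> _](_ : _ = (fun N => (qbracket Q (p ^ N)%:R)^-1 *
    \sum_(0 <= y < p ^ N) padic_pow Q (val (padic_Zp_nat y :
      padic_Zp C)) ^ b * Q ^+ y)) //.
apply/funext => N; rewrite summand qbE.
have := subrX1 (Q ^ (b + 1)) (p ^ N); move: (\sum_(y < p ^ N) _) => S ->.
have Qb1' : 1 - Q ^ (b + 1) != 0 by rewrite -oppr_eq0 opprB.
by field; rewrite PN QP PC Qb1'.
Qed.

Lemma volkenborn_exp_sum (Q : C) K (c : 'I_K -> C) (m : 'I_K -> int) :
  near1 Q -> Q != 1 ->
  volkenborn Q (fun y => \sum_(k < K) c k * padic_pow Q (val y) ^ m k) =
  \sum_(k < K) c k * ((1 - Q) * exp_mean Q (m k + 1)).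
Proof.
move=> Q1 Qn1; apply: padic_limE.
have := @padic_cvg_sum _ _ _ _ (index_enum 'I_K) _ _ (fun k => padic_cvgM
  (padic_cvg_cst (c k)) (@volkenborn_sum_cvg Q (m k) Q1 Qn1)).
rewrite [X in X @ _ --> _ -> _](_ : _ = (fun N => (qbracket Q (p ^ N)%:R)^-1 *
    \sum_(0 <= y < p ^ N) (\sum_(k < K) c k * padic_pow Q (val (padic_Zp_nat y :
      padic_Zp C)) ^ m k) * Q ^+ y)) //.
apply/funext => N; under [in RHS]eq_bigr do rewrite mulr_suml.
rewrite exchange_big mulr_sumr; apply: eq_bigr => k _ /=.
rewrite mulrCA mulr_sumr; congr (_ * _); apply: eq_bigr => y _; exact: mulrA.
Qed.

(** Integrating out the head variable replaces its exponential by a constant,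
    absorbed in the coefficients; hence the induction with [c] and [m]
    general. *)
Lemma volkenborn_iter_exp_sum (Q : C) K r (c : 'I_K -> C) (m : 'I_K -> nat -> int) :
  near1 Q -> Q != 1 ->
  volkenborn_iter Q (fun y : r.-tuple (padic_Zp C) =>
    \sum_(k < K) c k * \prod_(l < r) padic_pow Q (val (tnth y l)) ^ m k l) =
  \sum_(k < K) c k * \prod_(l < r) ((1 - Q) * exp_mean Q (m k l + 1)).
Proof.
move=> Q1 Qn1; elim: r c m => [|r IH] c m /=.
  by apply: eq_bigr => k _; rewrite !big_ord0.
transitivity (volkenborn_iter Q (fun t : r.-tuple (padic_Zp C) => \sum_(k < K)
    (c k * ((1 - Q) * exp_mean Q (m k 0%N + 1))) *
    \prod_(l < r) padic_pow Q (val (tnth t l)) ^ m k l.+1)); last first.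
  by rewrite (IH _ (fun k l => m k l.+1)); apply: eq_bigr => k _;
    rewrite big_ord_recl -!mulrA.
congr (volkenborn_iter Q _); apply/funext => t.
transitivity (volkenborn Q (fun y => \sum_(k < K)
    (c k * \prod_(l < r) padic_pow Q (val (tnth t l)) ^ m k l.+1) * padic_pow Q
      (val y) ^ m k 0%N)).
  congr (volkenborn Q _); apply/funext => y; apply: eq_bigr => k _.
  rewrite big_ord_recl /= -mulrA [X in _ = _ * X]mulrC; congr (_ * (_ * _)).
  by apply: eq_bigr => l _; rewrite tnthS.
by rewrite volkenborn_exp_sum //; apply: eq_bigr => k _; rewrite mulrAC.
Qed.

(** The hypothesis on [z] is the one under which [padic_pow Q z] is given by a
    convergent series; [z] itself may lie outside the unit disc, as the fraction
    [w2 / w1] in the theorem does. *)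
Lemma qbernoulliE n h r (Q z : C) : near1 Q -> Q != 1 -> av (z * padic_log Q) <
  rho ->
  qbernoulli n h r Q z = \sum_(k < n.+1)
    ((1 - Q) ^- n * ((-1) ^+ k * 'C(n, k)%:R * padic_pow Q z ^+ k)) *
    \prod_(l < r) ((1 - Q) * exp_mean Q (k%:Z + (h - l.+1%:Z) + 1)).
Proof.
move=> Q1 Qn1 zQ.
rewrite -(volkenborn_iter_exp_sum _ _ (fun (k :
  'I_n.+1) l => k%:Z + (h - l.+1%:Z)) Q1 Qn1).
congr (volkenborn_iter Q _); apply/funext => y.
have y1 l : av (val (tnth y l)) <= 1 by exact: padic_Zp_le1.
have y0 l : padic_pow Q (val (tnth y l)) != 0.
  exact/(near1_neq0 p_prime)/(padic_exp_near1 p_prime C_complete)/padic_pow_dom.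
rewrite padic_pow_sum //; last first.
  move=> l; rewrite padic_absM -[leRHS]mulr1 ler_pM ?padic_abs_ge0 //.
  by case: (h - _) => m; rewrite ?NegzE ?mulrNz ?padic_absN padic_abs_nat.
under [X in _ * X = _]eq_bigr do rewrite padic_powMz //.
have -> : qbracket Q (z + \sum_(l < r) val (tnth y l)) =
    (1 - padic_pow Q z * \prod_(l < r) padic_pow Q (val (tnth y l))) / (1 - Q).
  rewrite -padic_pow_sum // /qbracket padic_powD //.
  elim/big_rec: _ => [|l v _ v1]; first by rewrite padic_abs0 ler01.
  exact: padic_absD_le.
rewrite expr_div_n exprBn -mulrA mulr_suml; apply: eq_bigr => k _.
rewrite expr1n mulr1 exprMn -mulr_natr.
have -> : \prod_(l < r) padic_pow Q (val (tnth y l)) ^ (k%:Z + (h - l.+1%:Z)) =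
    (\prod_(l < r) padic_pow Q (val (tnth y l))) ^+ k *
    \prod_(l < r) padic_pow Q (val (tnth y l)) ^ (h - l.+1%:Z).
  rewrite -prodrXl -big_split /=; apply: eq_bigr => l _.
  exact: (expfzDr _ _ (y0 l)).
ring.
Qed.

End Volkenborn.

(** * The symmetric expansion *)

Section Symmetry.
Context {R : realType} {p : nat} (p_prime : prime p) {C : padicFieldType R p}.
Context (C_complete : forall F : set_system C, ProperFilter F -> cauchy F -> cvg F).
Context (q : C) (q_near1 : near1 q) (q_neq1 : q != 1).
Local Notation av := (@padic_abs R p C).

Let q0 : q != 0 := near1_neq0 p_prime q_near1.

(** The contribution of one index [l] to the [k]-th binomial term of a side of
    the theorem: the sum over [j_l] times the integral over [y_l]. *)
Definition weighted_mean (w1 w2 : nat) (b : int) : C :=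
  (\sum_(j < w1) q ^ (w2%:Z * b * j%:Z)) * exp_mean (q ^+ w1) b.

(** For [b] nonzero the sum is geometric and the closed form in [geom] is
    symmetric in [v] and [w]; for [b = 0] the [w1] equal summands cancel the
    factor of log (q^w1) = w1 log q. *)
Lemma weighted_mean_sym w1 w2 b : (0 < w1)%N -> (0 < w2)%N ->
  weighted_mean w1 w2 b = weighted_mean w2 w1 b.
Proof.
move=> w1_gt0 w2_gt0; rewrite /weighted_mean /exp_mean.
have [->|b0] := eqVneq b 0.
  have E v w : (0 < v)%N -> (\sum_(j < v) q ^ (w%:Z * 0 * j%:Z)) * - (padic_log
    (q ^+ v))^-1 =
      - (padic_log q)^-1.
    move=> v0; have vC : v%:R != 0 :> C by rewrite (padic_natr_neq0 p_prime).
    under eq_bigr do rewrite mulr0 mul0r expr0z.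
    by rewrite sumr_const card_ord padic_logX // invfM mulrN mulrA divff // mul1r.
  by rewrite !E.
have geom v w : (0 < v)%N -> (0 < w)%N -> (\sum_(j < v) q ^ (w%:Z * b * j%:Z)) *
  (b%:~R / (1 - (q ^+ v) ^ b)) =
    (1 - q ^ (v%:Z * w%:Z * b)) * b%:~R / ((1 - q ^ (w%:Z * b)) *
      (1 - q ^ (v%:Z * b))).
  move=> v0 w0.
  have qn1 u : (0 < u)%N -> 1 - q ^ (u%:Z * b) != 0.
    move=> u0; rewrite subr_eq0 eq_sym near1_exprz_neq1 // mulf_neq0 //.
    by rewrite -lt0n.
  have := subrX1 (q ^ (w%:Z * b)) v.
  have powX (u : int) m : (q ^ u) ^+ m = q ^ (u * m%:Z) by rewrite exprnP exprz_exp.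
  under eq_bigr do rewrite powX.
  rewrite powX [_ * v%:Z]mulrC mulrA => E.
  have -> : 1 - q ^ (v%:Z * w%:Z * b) =
      (\sum_(j < v) q ^ (w%:Z * b * j%:Z)) * (1 - q ^ (w%:Z * b)).
    by rewrite -[LHS]opprB E -mulNr opprB mulrC.
  rewrite exprnP exprz_exp.
  by field; rewrite !qn1.
by rewrite !geom // (mulrC w1%:Z) [X in _ / X]mulrC.
Qed.

(** One side of the theorem.  The exponents linear in [j] are the phase of the
    outer sum and the factor [q ^+ (w2 * \sum_l j_l)] produced by the shift of
    the argument; together they split as a product over [l], so that the sum
    over all [j] is the product of [r] sums over one index. *)
Lemma qbernoulli_sum_expansion n h r w1 w2 x : (0 < w1)%N -> av x <= 1 ->
  qbracket q w1%:R ^ (n%:Z - r%:Z) *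
    \sum_(j : {ffun 'I_r -> 'I_w1})
      q ^ (w2%:Z * \sum_(l < r) (h - l.+1%:Z + 1) * (j l)%:Z) *
      qbernoulli n h r (q ^+ w1)
        (w2%:R * x + w2%:R / w1%:R * \sum_(l < r) (j l)%:R)
  = (1 - q) ^ (r%:Z - n%:Z) * \sum_(k < n.+1)
      (-1) ^+ k * 'C(n, k)%:R * padic_pow q ((w1 * w2)%:R * x) ^+ k *
      \prod_(l < r) weighted_mean w1 w2 (k%:Z + (h - l.+1%:Z) + 1).
Proof.
move=> w1_gt0 x1.
have Q1 := near1X p_prime w1 q_near1.
have Qn1 := near1_exprn_neq1 p_prime C_complete q_near1 q_neq1 w1_gt0.
have w1C : w1%:R != 0 :> C by rewrite (padic_natr_neq0 p_prime).
have A0 : 1 - q ^+ w1 != 0 by rewrite subr_eq0 eq_sym.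
have B0 : 1 - q != 0 by rewrite subr_eq0 eq_sym.
have argE (j : {ffun 'I_r -> 'I_w1}) :
    (w2%:R * x + w2%:R / w1%:R * \sum_(l < r) (j l)%:R) * padic_log (q ^+ w1) =
    ((w1 * w2)%:R * x + (w2 * \sum_(l < r) j l)%:R) * padic_log q.
  by rewrite padic_logX // !natrM natr_sum; field.
have wx1 : av ((w1 * w2)%:R * x) <= 1.
  by rewrite padic_absM -[leRHS]mulr1 ler_pM ?padic_abs_ge0 ?padic_abs_nat.
have wxj1 m : av ((w1 * w2)%:R * x + m%:R) <= 1 by rewrite padic_absD_le
  ?padic_abs_nat.
have powE (j : {ffun 'I_r -> 'I_w1}) :
    padic_pow (q ^+ w1) (w2%:R * x + w2%:R / w1%:R * \sum_(l < r) (j l)%:R) =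
    padic_pow q ((w1 * w2)%:R * x) * q ^+ (w2 * \sum_(l < r) j l).
  rewrite {1}/padic_pow argE -/(padic_pow q _) padic_powD ?padic_abs_nat
    ?padic_pow_nat //.
  exact: padic_pow_dom.
under eq_bigr => j _.
  rewrite qbernoulliE //; last by rewrite argE; exact: padic_pow_dom.
  rewrite powE mulr_sumr.
  over.
rewrite exchange_big !mulr_sumr; apply: eq_bigr => k _ /=.
have -> : \prod_(l < r) weighted_mean w1 w2 (k%:Z + (h - l.+1%:Z) + 1) =
    (\sum_(j : {ffun 'I_r -> 'I_w1}) \prod_(l < r)
      q ^ (w2%:Z * (k%:Z + (h - l.+1%:Z) + 1) * (j l)%:Z)) *
    \prod_(l < r) exp_mean (q ^+ w1) (k%:Z + (h - l.+1%:Z) + 1).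
  by rewrite -(bigA_distr_bigA (fun (l : 'I_r) (j : 'I_w1) =>
    q ^ (w2%:Z * (k%:Z + (h - l.+1%:Z) + 1) * j%:Z))) -big_split.
rewrite big_split /= prodr_const card_ord.
have -> : qbracket q w1%:R ^ (n%:Z - r%:Z) =
    (1 - q ^+ w1) ^+ n * (1 - q ^+ w1) ^- r * (1 - q) ^ (r%:Z - n%:Z).
  rewrite /qbracket padic_pow_nat // expfzMl exprz_inv opprB expfzDr // exprnN.
  by [].
have phaseE (j : {ffun 'I_r -> 'I_w1}) :
    \prod_(l < r) q ^ (w2%:Z * (k%:Z + (h - l.+1%:Z) + 1) * (j l)%:Z) =
    q ^ (w2%:Z * \sum_(l < r) (h - l.+1%:Z + 1) * (j l)%:Z) *
    (q ^+ (w2 * \sum_(l < r) j l)) ^+ k.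
  rewrite -exprM (exprnP q) -expfzDr //.
  rewrite -(big_morph _ (fun a b => expfzDr a b q0) (expr0z q)); congr (q ^ _).
  rewrite !PoszM (big_morph Posz PoszD (erefl _)) !mulr_sumr mulr_suml -big_split
    /=.
  by apply: eq_bigr => l _; ring.
under [in RHS]eq_bigr do rewrite phaseE.
rewrite mulr_suml !mulr_sumr; apply: eq_bigr => j _.
rewrite exprMn.
move: (q ^ (w2%:Z * _)) (_ ^ (r%:Z - n%:Z)) ((q ^+ (w2 * _)) ^+ k)
  (\prod_(_ < _) _) => u v w M.
have An := expf_neq0 n A0; have Ar := expf_neq0 r A0.
by field; rewrite An Ar.
Qed.

End Symmetry.

Local Close Scope classical_set_scope.

Theorem theorem5 (R : realType) (p : nat) (p_prime : prime p)
  (C : padicFieldType R p) (C_padic : is_padic_complex C)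
  (n : nat) (h : int) (r w1 w2 : nat)
  (r_gt0 : (0 < r)%N) (w1_gt0 : (0 < w1)%N) (w2_gt0 : (0 < w2)%N)
  (q : C) (q_neq1 : q != 1)
  (q_near1 : padic_abs (1 - q) < p%:R `^ (- (p%:R - 1)^-1) :> R)
  (x : C) (x_le1 : padic_abs x <= 1 :> R) :
  qbracket q w1%:R ^ (n%:Z - r%:Z) *
    \sum_(j : {ffun 'I_r -> 'I_w1})
      q ^ (w2%:Z * \sum_(l < r) (h - l.+1%:Z + 1) * (j l)%:Z) *
      qbernoulli n h r (q ^+ w1)
        (w2%:R * x + w2%:R / w1%:R * \sum_(l < r) (j l)%:R)
  = qbracket q w2%:R ^ (n%:Z - r%:Z) *
    \sum_(j : {ffun 'I_r -> 'I_w2})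
      q ^ (w1%:Z * \sum_(l < r) (h - l.+1%:Z + 1) * (j l)%:Z) *
      qbernoulli n h r (q ^+ w2)
        (w1%:R * x + w1%:R / w2%:R * \sum_(l < r) (j l)%:R).
Proof.
have C_complete := padic_complete C_padic.
rewrite !(qbernoulli_sum_expansion p_prime C_complete) //.
congr (_ * _); apply: eq_bigr => k _; rewrite (mulnC w2); congr (_ * _).
by apply: eq_bigr => l _; exact: weighted_mean_sym.
Qed.
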